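(* Let $p$ be a propositional atom and let $H$ be a closed generic theory. Let $(T_{KP})_0$ be the smallest closed theory containing $H$ and the formula $p\leftrightarrow\mathrm{K}\neg p$, and let $T_{KP}=(T_{KP})_0\cup\mathbf{T}$. Then for every set $S$ of propositional atoms with $p\notin S$, $\mathscr M_{(T_{KP})_0,S}\models T_{KP}$. In particular, $T_{KP}$ is consistent.
   Context: Fix a nonempty set of symbols called propositional atoms and a symbol $\mathrm{K}$ which is not a propositional atom. Formulas are defined recursively: every propositional atom is a formula; if $\varphi,\psi$ are formulas then so are $\neg\varphi$, $(\varphi\wedge\psi)$, $(\varphi\vee\psi)$, $(\varphi\rightarrow\psi)$; if $\varphi$ is a formula then so is $\mathrm{K}(\varphi)$. $\varphi\leftrightarrow\psi$ abbreviates $(\varphi\rightarrow\psi)\wedge(\psi\rightarrow\varphi)$. A formula is basic if it is a propositional atom or of the form $\mathrm{K}\varphi$. A theory is a set of formulas. A model is a function assigning a truth value to every basic formula; truth $\mathscr M\models\varphi$ of an arbitrary formula is defined from the values of basic formulas by the classical truth tables (formulas $\mathrm{K}\varphi$ are treated like atoms). $\mathscr M\models T$ means $\mathscr M\models\varphi$ for all $\varphi\in T$; $T\models\varphi$ means every model of $T$ satisfies $\varphi$; $T$ is consistent if some model satisfies $T$. A theory $T$ is closed if $\varphi\in T$ implies $\mathrm{K}\varphi\in T$. $\mathbf{T}$ is the set of all formulas $\mathrm{K}\varphi\rightarrow\varphi$. For a theory $T$ and a set $S$ of propositional atoms, $\mathscr M_{T,S}$ is the model with $\mathscr M_{T,S}\models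 q$ iff $q\in S$ for atoms $q$, and $\mathscr M_{T,S}\models\mathrm{K}\varphi$ iff $T\models\varphi$. A theory $T$ is closed generic if for every set $S$ of propositional atoms and every closed theory $T'\supseteq T$, $\mathscr M_{T',S}\models T$. *)

(* Defs.v *)
From mathcomp Require Import all_boot.
From mathcomp Require Import boolp classical_sets.
Set Implicit Arguments.
Unset Strict Implicit.
Unset Printing Implicit Defensive.
Local Open Scope classical_set_scope.

Inductive formula (A : Type) : Type :=
| Atom of A
| Neg of formula A
| And of formula A & formula A
| Or of formula A & formula A
| Imp of formula A & formula A
| K of formula A.

Definition Iff (A : Type) (phi psi : formula A) : formula A :=
  And (Imp phi psi) (Imp psi phi).

Definition is_basic (A : Type) (phi : formula A) : bool :=
  match phi with
  | Atom _ | K _ => true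
  | _ => false
  end.

Definition basic (A : Type) : Type := {phi : formula A | is_basic phi}.

Definition theory (A : Type) : Type := set (formula A).

Definition model (A : Type) : Type := basic A -> bool.

(* The proof [isT] typechecks because [is_basic] computes to [true] on
   [Atom q] and on [K psi]; there is no recursive call under [K]. *)
Fixpoint truth (A : Type) (M : model A) (phi : formula A) : bool :=
  match phi with
  | Atom q => M (exist _ (Atom q) isT)
  | Neg psi => ~~ truth M psi
  | And psi chi => truth M psi && truth M chi
  | Or psi chi => truth M psi || truth M chi
  | Imp psi chi => truth M psi ==> truth M chi
  | K psi => M (exist _ (K psi) isT)
  end.

Definition models (A : Type) (M : model A) (T : theory A) : Prop :=
  forall phi, T phi -> truth M phi.

Definition entails (A : Type) (T : theory A) (phi : formula A) : Prop :=
  forall M : model A, models M T -> truth M phi.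

Definition consistent (A : Type) (T : theory A) : Prop :=
  exists M : model A, models M T.

Definition closed_theory (A : Type) (T : theory A) : Prop :=
  forall phi, T phi -> T (K phi).

Definition schemeT (A : Type) : theory A :=
  [set Imp (K phi) phi | phi in [set: formula A]].

(* The last branch is unreachable: [b] is a basic formula. *)
Definition canonical_model (A : Type) (T : theory A) (S : set A) : model A :=
  fun b : basic A =>
    match sval b with
    | Atom q => `[< S q >]
    | K phi => `[< entails T phi >]
    | _ => false
    end.

Definition closed_generic (A : Type) (T : theory A) : Prop :=
  forall (S : set A) (T' : theory A),
    closed_theory T' -> T `<=` T' -> models (canonical_model T' S) T.

(* [smallest C G] is the intersection of all sets satisfying [C] and
   containing [G]; [TKP0_least] checks that it is a least element here. *)
Definition TKP0 (A : Type) (H : theory A) (p : A) : theory A :=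
  smallest (@closed_theory A)
    (H `|` [set Iff (Atom p) (K (Neg (Atom p)))]).

Definition TKP (A : Type) (H : theory A) (p : A) : theory A :=
  TKP0 H p `|` @schemeT A.

Lemma TKP0_least (A : Type) (H : theory A) (p : A) :
  [/\ closed_theory (TKP0 H p),
      H `<=` TKP0 H p,
      TKP0 H p (Iff (Atom p) (K (Neg (Atom p))))
    & forall T : theory A, closed_theory T -> H `<=` T ->
        T (Iff (Atom p) (K (Neg (Atom p)))) -> TKP0 H p `<=` T].
Proof.
split.
- move=> phi Hphi T [cT sT]; exact: (cT _ (Hphi T (conj cT sT))).
- by move=> phi Hphi T [_ sT]; apply: sT; left.
- by move=> T [_ sT]; apply: sT; right.
- move=> T cT HT pT; apply: smallest_sub => // phi [hphi|->].
  + exact: HT.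
  + exact: pT.
Qed.

(* Main.v *)
Require Import Defs.
From mathcomp Require Import all_boot.
From mathcomp Require Import boolp classical_sets.

(** Write [T0] for [TKP0 H p]. If [T0] entailed [~ p], then the canonical model
of [T0] at [[set p]] would satisfy both [p] and [K (~ p)], hence all of [T0],
hence [~ p]: a contradiction. So [T0] does not entail [~ p], and in the
canonical model of [T0] at any [S] not containing [p], both sides of
[p <-> K (~ p)] are false. *)

(** By minimality of [TKP0 H p]: its true members form a closed theory, which contains [H] by
    genericity. *)
Lemma canonical_model_TKP0 (A : Type) (p : A) (H : theory A) (S : set A) :
  closed_generic H ->
  truth (canonical_model (TKP0 H p) S) (Iff (Atom p) (K (Neg (Atom p)))) ->
  models (canonical_model (TKP0 H p) S) (TKP0 H p).
Proof.
move=> hH Mp; have [T0closed HT0 T0p T0min] := TKP0_least H p.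
set M := canonical_model _ _ in Mp *.
(* Membership is carried along because truth of [K phi] in [M] means that [TKP0 H p] entails [phi];
   truth of [phi] in [M] would not give this. *)
suff sub : (TKP0 H p `<=` [set phi | TKP0 H p phi /\ truth M phi])%classic.
  by move=> phi /sub[].
apply: T0min => [phi [T0phi _]|phi Hphi|//].
- by split; [exact: T0closed|apply/asboolP => N; apply].
- by split; [exact: HT0|exact: hH T0closed HT0 _ Hphi].
Qed.

Lemma TKP0_not_entails_neg (A : Type) (p : A) (H : theory A) :
  closed_generic H -> ~ entails (TKP0 H p) (Neg (Atom p)).
Proof.
move=> hH Tnp.
have Mp : truth (canonical_model (TKP0 H p) [set p]%classic) (Atom p).
  exact/asboolP.
have MKnp : truth (canonical_model (TKP0 H p) [set p]%classic)
                  (K (Neg (Atom p))).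
  exact/asboolP.
have /Tnp : models (canonical_model (TKP0 H p) [set p]%classic) (TKP0 H p).
  apply: canonical_model_TKP0 => //.
  by move: Mp MKnp => /= -> ->.
by move: Mp => /= ->.
Qed.

Theorem theorem20 (A : Type) (p : A) (H : theory A)
    (hH : closed_generic H) :
  (forall S : set A, ~ S p ->
     models (canonical_model (TKP0 H p) S) (TKP H p)) /\
  consistent (TKP H p).
Proof.
suff MT (S : set A) : ~ S p ->
    models (canonical_model (TKP0 H p) S) (TKP H p).
  by split=> //; exists (canonical_model (TKP0 H p) set0); apply: MT.
move=> Sp.
have MT0 : models (canonical_model (TKP0 H p) S) (TKP0 H p).
  apply: canonical_model_TKP0 => //=.
  rewrite /canonical_model /= (asboolF Sp).
  by rewrite (asboolF (@TKP0_not_entails_neg A p H hH)).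
move=> _ [/MT0 //|[phi _ <-]].
(* Truth of [K phi] here says that every model of [TKP0 H p] satisfies [phi], and by [MT0] this
   model is one of them. *)
by apply/implyP => /asboolP; apply.
Qed.
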